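(* The problem Maximum Matching Cut is solvable in polynomial time on bipartite graphs of diameter at most $3$.
   Context: Graphs are finite, simple and undirected. The distance $\mathrm{dist}(u,v)$ is the length of a shortest path from $u$ to $v$; a graph has diameter at most $k$ if $\mathrm{dist}(u,v)\le k$ for all vertices $u,v$ (in particular such a graph is connected). A matching $M\subseteq E(G)$ is a set of pairwise non-adjacent edges. A matching $M$ is a matching cut of $G$ if there is a partition of $V(G)$ into two non-empty sets $A$ and $B$ such that the edges of $M$ are exactly the edges of $G$ with one endvertex in $A$ and one in $B$. The size of a matching cut is its number of edges. The problem Maximum Matching Cut takes a graph $G$ as input and asks for the maximum size of a matching cut of $G$ (or to report that $G$ has no matching cut). *)

(* Defs.v *)
From mathcomp Require Import all_boot all_order all_algebra.

Set Implicit Arguments.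
Unset Strict Implicit.
Unset Printing Implicit Defensive.

Record sgraph (V : finType) := SGraph {
  edge :> rel V;
  edge_sym : symmetric edge;
  edge_irrefl : irreflexive edge }.

Section Graphs.
Variables (V : finType) (G : sgraph V).

Definition edge_set : {set {set V}} :=
  [set e | [exists x, exists y, edge G x y && (e == [set x; y])]].

Definition bipartite : Prop :=
  exists A B : {set V},
    [/\ A :|: B = [set: V], [disjoint A & B]
      & forall x y, edge G x y ->
          (x \in A) && (y \in B) || (x \in B) && (y \in A)].

(* The path is [u :: p]; its length, in edges, is [size p]. *)
Definition upath (u v : V) (p : seq V) : bool :=
  [&& path (edge G) u p, last u p == v & uniq (u :: p)].

(* [is_dist u v] holds of no number when [u] and [v] are not connected. *)
Definition is_dist (u v : V) (d : nat) : Prop :=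
  (exists2 p, upath u v p & size p = d) /\
  (forall p, upath u v p -> d <= size p).

Definition diameter_at_most (k : nat) : Prop :=
  forall u v, exists2 d, is_dist u v d & d <= k.

Definition cut_edges (A B : {set V}) : {set {set V}} :=
  [set e in edge_set | [exists x in A, exists y in B, e == [set x; y]]].

(* For sets of edges, [trivIset] says that distinct members are disjoint. *)
Definition matching (M : {set {set V}}) : Prop :=
  M \subset edge_set /\ trivIset M.

Definition matching_cut (M : {set {set V}}) : Prop :=
  matching M /\
  exists A B : {set V},
    [/\ A != set0, B != set0, A :|: B = [set: V], [disjoint A & B]
      & M = cut_edges A B].

(* [None] is the answer "there is no matching cut". *)
Definition max_matching_cut (answer : option nat) : Prop :=
  match answer with
  | Some k => (exists2 M, matching_cut M & #|M| = k) /\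
              (forall M, matching_cut M -> #|M| <= k)
  | None => forall M, ~ matching_cut M
  end.

End Graphs.

(* Random access machine with unit cost per instruction. Without a            *)
(* multiplication instruction, each step lengthens the binary representation  *)
(* of the largest stored number by at most one bit, up to the constants of    *)
(* the program, so that polynomial time on this machine is polynomial time on *)
(* a Turing machine.                                                          *)
Inductive instr :=
  | IConst of nat & nat
  | IAdd of nat & nat & nat
  | ISub of nat & nat & nat
  | IRead of nat & nat
  | IWrite of nat & nat
  | IJump of nat
  | IJzero of nat & nat.

Definition program := seq instr.

Record config := Config {
  pc : nat;
  reg : nat -> nat;
  memory : nat -> nat }.

Definition upd (f : nat -> nat) (a v : nat) : nat -> nat :=
  fun b => if b == a then v else f b.

Definition exec (i : instr) (c : config) : config :=
  let: Config l r m := c in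
  match i with
  | IConst a k => Config l.+1 (upd r a k) m
  | IAdd a b d => Config l.+1 (upd r a (r b + r d)) m
  | ISub a b d => Config l.+1 (upd r a (r b - r d)) m
  | IRead a b => Config l.+1 (upd r a (m (r b))) m
  | IWrite a b => Config l.+1 r (upd m (r a) (r b))
  | IJump k => Config k r m
  | IJzero a k => Config (if r a == 0 then k else l.+1) r m
  end.

Definition halted (P : program) (c : config) : bool := size P <= pc c.

(* A halted configuration is a fixpoint, hence being halted after [t] steps   *)
(* means having halted within [t] steps.                                      *)
Definition step (P : program) (c : config) : config :=
  if onth P (pc c) is Some i then exec i c else c.

(* The number of vertices is in register 0 and the adjacency matrix is in     *)
(* memory, row by row; everything else is 0.                                  *)
Definition init (n : nat) (G : sgraph 'I_n) : config :=
  Config 0 (upd (fun=> 0) 0 n)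
    (fun a => [exists i : 'I_n, exists j : 'I_n,
                 (a == i * n + j) && edge G i j] : nat).

(* Register 0 tells whether there is an answer, and register 1 holds it. *)
Definition output (c : config) : option nat :=
  if reg c 0 == 0 then None else Some (reg c 1).

(* The time bound is a polynomial in the number of vertices; the input        *)
(* consists of [n] and [n ^ 2] bits. Nothing is required of the program on    *)
(* graphs outside the class.                                                  *)
Definition solvable_in_polynomial_time
    (problem : forall n, sgraph 'I_n -> option nat -> Prop)
    (class : forall n, sgraph 'I_n -> Prop) : Prop :=
  exists (P : program) (p : {poly nat}),
    forall (n : nat) (G : sgraph 'I_n), class n G ->
      let c := iter p.[n]%R (step P) (init G) in
      halted P c /\ problem n G (output c).

(* Main.v *)
Require Import Defs.
From mathcomp Require Import all_boot all_order all_algebra zify.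

(** A matching cut is a colouring of the vertices with two colours, both used,
    in which every vertex has at most one neighbour of the other colour; its
    size is the number of bichromatic edges. In a bipartite graph of diameter
    at most 3, two vertices of the same class are at even distance, hence have
    a common neighbour. This leaves so little freedom that every such
    colouring is described by fifteen vertices through one fixed formula
    ([colouring_definable]). Hence there are only polynomially many matching
    cuts, and trying all tuples of fifteen vertices finds a largest one.

    To describe a colouring inside one class S, let A be the first colour and
    choose x1 in A and x2 outside A, both in S, together with their neighbours
    y1 and y2 of the other colour, if any. All neighbours of x1 but y1 lie in
    A, so a vertex z of S with two of them as neighbours lies in A; so does
    every neighbour of y2 other than x2. Call these vertices, and x1 itself,
    forced, and call residue what remains of the class S inside A; exchanging
    the colours gives the forced vertices outside A and a second residue. A
    vertex z of the first residue and a vertex q of the second have a common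
    neighbour v, which is the only neighbour of other colour of z or of q. For
    given q, at most one z is served by a v outside A, and for given z at most
    one q by a v in A ([common_opposite_neighbour]). With three vertices z and
    two vertices q, there would be six pairs and room for only 2 + 3 of them.
    So one of the residues consists of at most two vertices a and b
    ([residue_small]), and the vertices of S of its colour are a, b and those
    forced to this colour ([exceptional_colouring]).

    The search needs no working memory: it is written as two arithmetic
    expressions with sums over all vertices. The nesting depth of the sums is
    fixed, so that evaluating the expressions term by term takes polynomial
    time. [compile] translates them into machine code whose running time
    depends on the number of vertices only ([compile_correct],
    [runtime_poly]). The maximum is computed as the number of k for which some
    tuple describes a matching cut with more than k edges. *)

Set Implicit Arguments.
Unset Strict Implicit.
Unset Printing Implicit Defensive.

(** * Matching cuts as vertex colourings *)

Section Cuts.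
Variables (V : finType) (G : sgraph V).
Implicit Types (A S : {set V}) (M : {set {set V}}).

Definition single_opposite A : bool :=
  [forall z, forall w, forall w',
     [&& edge G z w, edge G z w', (w \in A) != (z \in A)
       & (w' \in A) != (z \in A)] ==> (w == w')].

Lemma single_oppositeP A :
  reflect (forall z w w', edge G z w -> edge G z w' ->
             (w \in A) != (z \in A) -> (w' \in A) != (z \in A) -> w = w')
          (single_opposite A).
Proof.
apply: (iffP 'forall_'forall_'forall_implyP) => H z w w'.
  by move=> e e' c c'; apply/eqP; apply: (H z w w'); rewrite e e' c.
by case/and4P=> e e' c c'; apply/eqP; apply: H e e' c c'.
Qed.

Lemma single_oppositeC A : single_opposite (~: A) = single_opposite A.
Proof.
by apply: eq_forallb => z; apply: eq_forallb => w; apply: eq_forallb => w';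
  rewrite !inE !(inj_eq negb_inj).
Qed.

Definition proper_cut A : bool :=
  [&& A != set0, ~: A != set0 & single_opposite A].

Definition crossing A : {set V * V} :=
  [set e | [&& e.1 \in A, e.2 \notin A & edge G e.1 e.2]].

Lemma cut_edgesE A :
  cut_edges G A (~: A) = [set [set e.1; e.2] | e in crossing A].
Proof.
apply/setP=> e; rewrite !inE; apply/andP/imsetP.
  case=> /existsP[x /existsP[y /andP[xy /eqP->]]].
  case/existsP=> a /andP[aA /existsP[b /andP[]]]; rewrite inE => bA /eqP E.
  exists (a, b) => //=; rewrite inE /= aA bA /=.
  have := set21 a b; have := set22 a b; rewrite -E !inE.
  case/orP=> /eqP Eb /orP[] /eqP Ea; subst a b => //.
  - by rewrite aA in bA.
  - by rewrite edge_sym.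
  by rewrite aA in bA.
case=> [[x y]]; rewrite inE /= => /and3P[xA yA xy] ->; split.
  by apply/existsP; exists x; apply/existsP; exists y; rewrite xy /=.
apply/existsP; exists x; rewrite xA; apply/existsP; exists y.
by rewrite inE yA /=.
Qed.

Lemma card_cut_edges A : #|cut_edges G A (~: A)| = #|crossing A|.
Proof.
rewrite cut_edgesE card_in_imset // => [[x y] [x' y']].
rewrite !inE /= => /and3P[xA yA _] /and3P[xA' yA' _] E.
have := set21 x y; rewrite E !inE => /orP[] /eqP ?; last first.
  by subst; rewrite xA in yA'.
have := set22 x y; rewrite E !inE => /orP[] /eqP ?; last first.
  by subst.
by subst; rewrite xA' in yA.
Qed.

(** Every vertex of [A] starts at most one crossing edge. *)
Lemma card_crossing_le A : single_opposite A -> #|crossing A| <= #|V|.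
Proof.
move/single_oppositeP=> H; rewrite -(card_in_imset (f := fst)) ?max_card //.
move=> [x y] [x' y']; rewrite !inE /= => /and3P[xA yA e] /and3P[_ yA' e'] E.
subst x'; congr pair; apply: H e e' _ _; rewrite xA.
  by rewrite (negbTE yA).
by rewrite (negbTE yA').
Qed.

Lemma matching_cutP M :
  matching_cut G M <-> exists2 A, proper_cut A & M = cut_edges G A (~: A).
Proof.
split.
  case=> [[_ /trivIsetP T]] [A [B [A0 B0 AB dAB EM]]].
  have EB : B = ~: A.
    apply/setP=> z; rewrite !inE; have := in_setT z; rewrite -AB inE.
    by have := disjointFr dAB (x := z); case: (z \in A) => [->|].
  subst B; exists A => //; apply/and3P; split=> //.
  apply/single_oppositeP.
  have C x y : edge G x y -> (y \in A) != (x \in A) -> [set x; y] \in M.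
    rewrite EM cut_edgesE => e; case xA: (x \in A) => yA.
      apply/imsetP; exists (x, y) => //; rewrite inE /= xA e.
      by case: (y \in A) yA.
    apply/imsetP; exists (y, x); rewrite /= 1?setUC //.
    by rewrite inE /= xA edge_sym e; case: (y \in A) yA.
  move=> z w w' e e' c c'; have Mw := C _ _ e c; have Mw' := C _ _ e' c'.
  case: (eqVneq [set z; w] [set z; w']) => [E|N]; last first.
    have := disjointFr (T _ _ Mw Mw' N) (set21 z w).
    by rewrite set21.
  have := set22 z w; rewrite E !inE => /orP[] /eqP // ?; subst w.
  by rewrite eqxx in c.
case=> A /and3P[A0 B0 /single_oppositeP H] ->; split; last first.
  exists A, (~: A); split=> //; first by rewrite setUCr.
  by rewrite disjoints_subset setCK.
split; first by apply/subsetP=> e; rewrite inE => /andP[].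
apply/trivIsetP=> e1 e2; rewrite cut_edgesE.
case/imsetP=> [[x y]]; rewrite inE /= => /and3P[xA yA xy] ->.
case/imsetP=> [[u v]]; rewrite inE /= => /and3P[uA vA uv] -> N.
rewrite -setI_eq0; apply/eqP/setP=> z; rewrite !inE; apply/negP.
case/andP=> /orP[] /eqP ? /orP[] /eqP ?; subst; move: N; apply/negP; rewrite negbK.
- suff -> : y = v by [].
  by apply: H xy uv _ _; rewrite uA (negbTE yA, negbTE vA).
- by rewrite xA in vA.
- by rewrite uA in yA.
suff -> : x = u by [].
by apply: (H v); rewrite 1?edge_sym ?xA ?uA ?(negbTE vA).
Qed.

(** * Describing the cuts of a bipartite graph of diameter 3 *)

Definition bipartition S : Prop :=
  forall x y, edge G x y -> (x \in S) != (y \in S).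

Definition codegrees_positive S : Prop :=
  forall x y, x != y -> (x \in S) = (y \in S) ->
    exists2 w, edge G x w & edge G y w.

Lemma bipartite_bipartition : bipartite G -> exists S, bipartition S.
Proof.
case=> A [B [_ dAB H]]; exists A => x y /H /orP[] /andP[].
  by move=> xA yB; rewrite xA (disjointFl dAB yB).
by move=> xB yA; rewrite yA (disjointFl dAB xB).
Qed.

(** A path of odd length changes sides, so a shortest path between distinct
    vertices of one side has length 2 if it has length at most 3. *)
Lemma diameter3_codegrees S :
  bipartition S -> diameter_at_most G 3 -> codegrees_positive S.
Proof.
move=> bS D x y xy Sxy; case: (D x y) => d [[p /and3P[Pp /eqP L _] <-] _].
case: p Pp L => [|a [|b [|c [|? ?]]]] //= Pp L _; subst => //.
- by rewrite eqxx in xy.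
- by case/andP: Pp => /bS; rewrite Sxy eqxx.
- by case/and3P: Pp => xa ab _; exists a => //; rewrite edge_sym.
case/and4P: Pp => /bS xa /bS ab /bS bc _.
by move: xa ab bc; rewrite Sxy; do 3!case: (_ \in S).
Qed.

Definition two_common_neighbours (x y z : V) : bool :=
  [exists w, exists w', [&& w != w', w != y, w' != y,
     edge G z w, edge G z w', edge G x w & edge G x w']].

(** The vertices on the side of [x1] that must have the colour of [x1], when
    [x2] has the other colour and [y1], [y2] are the neighbours of [x1], [x2]
    across the cut: see [exceptional_colouring]. *)
Definition forced x1 y1 x2 y2 z : bool :=
  [|| z == x1, edge G z y2 && (z != x2) | two_common_neighbours x1 y1 z].

Lemma two_common_neighboursPn x y z w w' :
  ~~ two_common_neighbours x y z -> w != y -> w' != y ->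
  edge G z w -> edge G z w' -> edge G x w -> edge G x w' -> w = w'.
Proof.
move=> N wy wy' zw zw' xw xw'; apply/eqP; apply: contraR N => ww'.
apply/existsP; exists w; apply/existsP; exists w'.
by apply/and5P; split=> //; apply/and3P.
Qed.

(** [y] stands for the neighbour of [x] across the cut. The last two conditions
    do not ask for an edge to [y], so that a dummy can meet them when [x] has
    no such neighbour. *)
Definition anchored S A x y : Prop :=
  [/\ x \in S, x \in A, forall w, edge G x w -> w \notin A -> w = y
    & forall z, z \in S -> edge G z y -> z != x -> z \notin A].

Lemma anchored_ex S A x :
  bipartition S -> single_opposite A -> x \in S -> x \in A ->
  exists y, anchored S A x y.
Proof.
move=> bS /single_oppositeP H xS xA.
case: (pickP [pred w | edge G x w & w \notin A]) => [y /andP[xy yA]|N].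
  exists y; split=> // [w xw wA|z zS zy zx].
    by apply: H xw xy _ _; rewrite xA ?(negbTE wA) ?(negbTE yA).
  apply: contra zx => zA; apply/eqP; apply: (H y); rewrite 1?edge_sym //.
    by rewrite zA (negbTE yA).
  by rewrite xA (negbTE yA).
(* The dummy [y] is [x] itself: its neighbours lie on the other side. *)
exists x; split=> // [w xw wA|z zS /bS]; last by rewrite zS xS.
by have := N w; rewrite /= xw wA.
Qed.

Definition residue S A x1 y1 x2 y2 : {set V} :=
  [set z in S | (z \in A) && ~~ forced x1 y1 x2 y2 z].

Section Residue.
Variables (S A : {set V}) (x1 y1 x2 y2 : V).
Hypotheses (bS : bipartition S) (cS : codegrees_positive S).
Hypotheses (HA : single_opposite A).
Hypotheses (a1 : anchored S A x1 y1) (a2 : anchored S (~: A) x2 y2).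

(** The vertex [v1] is the only neighbour of [z1] outside [A]. As [z1] is not
    forced, its common neighbour with [x2] is not [y2], so it lies outside [A]
    and equals [v1]; likewise [v2] is a neighbour of [x2] other than [y2]. But
    [q] is not forced either, so it shares only one such neighbour with [x2].
    Thus [v1] and [v2] coincide, and this vertex has at most one neighbour in
    [A]. *)
Lemma common_opposite_neighbour z1 z2 q v1 v2 :
  z1 \in residue S A x1 y1 x2 y2 -> z2 \in residue S A x1 y1 x2 y2 ->
  q \in residue S (~: A) x2 y2 x1 y1 ->
  edge G z1 v1 -> edge G q v1 -> edge G z2 v2 -> edge G q v2 ->
  v1 \notin A -> v2 \notin A -> z1 = z2.
Proof.
have [x2S x2A o2 _] := a2; move/single_oppositeP: (HA) => H.
have to_x2 z v : z \in residue S A x1 y1 x2 y2 -> edge G z v -> v \notin A ->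
    edge G x2 v /\ v != y2.
  rewrite !inE => /and3P[zS zA]; rewrite !negb_or => /and3P[_ zy2 _] zv vA.
  have zx2 : z != x2 by apply: contraTneq zA => ->; rewrite inE in x2A.
  have [|b zb x2b] := cS zx2; first by rewrite zS x2S.
  rewrite zx2 andbT in zy2.
  have by2 : b != y2 by apply: contraNneq zy2 => <-.
  have bA : b \notin A by apply: contra by2 => bA; rewrite (o2 b) // inE negbK.
  suff <- : b = v by [].
  by apply: H zb zv _ _; rewrite zA ?(negbTE bA) ?(negbTE vA).
move=> Q1 Q2; rewrite inE => /and3P[_ _]; rewrite !negb_or => /and3P[_ _ nq].
move=> zv1 qv1 zv2 qv2 vA1 vA2.
have [x2v1 v1y] := to_x2 _ _ Q1 zv1 vA1.
have [x2v2 v2y] := to_x2 _ _ Q2 zv2 vA2.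
have E := two_common_neighboursPn nq v1y v2y qv1 qv2 x2v1 x2v2; subst v2.
move: Q1 Q2; rewrite !inE => /and3P[_ zA1 _] /and3P[_ zA2 _].
by apply: (H v1); rewrite 1?edge_sym ?zA1 ?zA2 ?(negbTE vA1).
Qed.

(** Forced vertices lie in [A], and the two named vertices account for the
    vertices of [A] that are not forced. *)
Lemma exceptional_colouring : #|residue S A x1 y1 x2 y2| <= 2 ->
  exists a b, forall z, z \in S ->
    (z \in A) = [|| z == a, z == b | forced x1 y1 x2 y2 z].
Proof.
have [x1S x1A o1 _] := a1; have [x2S x2A _ s2] := a2.
move/single_oppositeP: (HA) => H Q2.
have forcedA z : z \in S -> forced x1 y1 x2 y2 z -> z \in A.
  move=> zS /or3P[/eqP-> // | /andP[zy zx] |].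
    by have := s2 z zS zy zx; rewrite inE negbK.
  case/existsP=> w /existsP[w' /and5P[ww' wy wy' zw /and3P[zw' xw xw']]].
  have wA : w \in A by apply: contraR wy => wA; rewrite (o1 w).
  have wA' : w' \in A by apply: contraR wy' => w'A; rewrite (o1 w').
  apply: contraR ww' => zA; apply/eqP; apply: H zw zw' _ _.
    by rewrite wA (negbTE zA).
  by rewrite wA' (negbTE zA).
(* A residue with fewer than two vertices is padded with [x1]. *)
have [a [b [aQ bQ Qab]]] : exists a b,
    [/\ a \in x1 |: residue S A x1 y1 x2 y2, b \in x1 |: residue S A x1 y1 x2 y2
      & {subset residue S A x1 y1 x2 y2 <= [set a; b]}].
  rewrite cardE in Q2; have E := mem_enum (residue S A x1 y1 x2 y2).
  case: (enum _) Q2 E => [|a [|b [|? ?]]] //= _ E.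
  - by exists x1, x1; split; rewrite ?setU11 // => z; rewrite -E.
  - exists a, x1; split; rewrite ?setU11 // ?in_setU1 -?E ?mem_head ?orbT // => z.
    by rewrite -E !inE => ->.
  exists a, b; split; rewrite ?in_setU1 -?E ?inE ?eqxx ?orbT // => z.
  by rewrite -E !inE.
have inA c : c \in x1 |: residue S A x1 y1 x2 y2 -> c \in A.
  by rewrite !inE => /orP[/eqP-> // | /and3P[]].
exists a, b => z zS; apply/idP/idP.
  move=> zA; case F: (forced _ _ _ _ _); first by rewrite !orbT.
  have : z \in [set a; b] by apply: Qab; rewrite inE zS zA F.
  by rewrite !inE orbF.
by case/or3P=> [/eqP-> | /eqP-> |]; [apply: inA | apply: inA | apply: forcedA].
Qed.

End Residue.

Lemma anchoredC S A x y : anchored S A x y -> anchored S (~: ~: A) x y.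
Proof. by rewrite setCK. Qed.

(** Three vertices [z1], [z2], [z3] of one residue and two vertices [q1], [q2]
    of the other would form six pairs, each with a common neighbour. Those
    outside [A] serve at most one pair for each of [q1], [q2]; those in [A]
    serve at most one pair for each [zi]: five pairs at most. *)
Lemma residue_small S A x1 y1 x2 y2 :
  bipartition S -> codegrees_positive S -> single_opposite A ->
  anchored S A x1 y1 -> anchored S (~: A) x2 y2 ->
  (#|residue S A x1 y1 x2 y2| <= 2) || (#|residue S (~: A) x2 y2 x1 y1| <= 1).
Proof.
move=> bS cS HA a1 a2; rewrite -[_ || _]negbK negb_or -!ltnNge.
apply/negP=> /andP[/card_gt2P[z1 [z2 [z3 [[Z1 Z2 Z3] [z12 z23 z31]]]]]].
case/card_gt1P=> q1 [q2 [Q1 Q2 q12]].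
have HA' : single_opposite (~: A) by rewrite single_oppositeC.
pose R z q := exists v, [/\ edge G z v, edge G q v & v \in A].
pose B z q := exists v, [/\ edge G z v, edge G q v & v \notin A].
have RB z q : z \in residue S A x1 y1 x2 y2 ->
    q \in residue S (~: A) x2 y2 x1 y1 -> R z q \/ B z q.
  rewrite !inE => /and3P[zS zA _] /and3P[qS qA _].
  have [||v zv qv] := cS z q.
  - by apply: contraNneq qA => <-.
  - by rewrite zS qS.
  by case vA: (v \in A); [left | right]; exists v; rewrite vA.
have BB z z' q : z \in residue S A x1 y1 x2 y2 ->
    z' \in residue S A x1 y1 x2 y2 -> q \in residue S (~: A) x2 y2 x1 y1 ->
    B z q -> B z' q -> z = z'.
  move=> Z Z' Q [v [zv qv vA]] [v' [zv' qv' vA']].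
  exact: common_opposite_neighbour HA a2 _ _ _ _ _ Z Z' Q zv qv zv' qv' vA vA'.
have RR z q q' : z \in residue S A x1 y1 x2 y2 ->
    q \in residue S (~: A) x2 y2 x1 y1 -> q' \in residue S (~: A) x2 y2 x1 y1 ->
    R z q -> R z q' -> q = q'.
  move=> Z Q Q' [v [zv qv vA]] [v' [zv' qv' vA']].
  have Z' : z \in residue S (~: ~: A) x1 y1 x2 y2 by rewrite setCK.
  apply: (common_opposite_neighbour cS HA' (anchoredC a1) Q Q' Z' qv zv qv' zv').
    by rewrite inE negbK.
  by rewrite inE negbK.
move/eqP: z12 => z12; move/eqP: z23 => z23; move/eqP: z31 => z31.
move/eqP: q12 => q12.
(* By [RR], each of the three [z] uses [B] with [q1] or [q2]; two of them
   do so with the same one, against [BB]. *)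
have N z : z \in residue S A x1 y1 x2 y2 -> B z q1 \/ B z q2.
  move=> Z; case: (RB z q1 Z Q1) => [R1|]; last by left.
  case: (RB z q2 Z Q2) => [R2|]; last by right.
  by case: q12; apply: RR Z Q1 Q2 R1 R2.
case: (N _ Z1) => b1; case: (N _ Z2) => b2; case: (N _ Z3) => b3.
all: by [ case: z12; apply: (BB _ _ _ Z1 Z2 _ b1 b2)
        | case: z23; apply: (BB _ _ _ Z2 Z3 _ b2 b3)
        | case: z31; apply: (BB _ _ _ Z3 Z1 _ b3 b1) ].
Qed.

(** The boolean [c] tells whether the formula describes [A] or its complement,
    according to which of the two residues is small. The vertex [t] of the
    other side serves to describe the empty set, which is needed when [S] has
    only one colour. *)
Lemma side_colouring S A t :
  bipartition S -> codegrees_positive S -> single_opposite A -> t \notin S ->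
  exists c x1 y1 x2 y2 a b, forall z, z \in S ->
    (z \in A) = (c == [|| z == a, z == b | forced x1 y1 x2 y2 z]).
Proof.
move=> bS cS HA tS.
have trivial s z : s \in S -> z \in S ->
    [|| z == t, z == t | forced t t t s z] = false.
  move=> sS zS; have zt : (z == t) = false by apply: contraNF tS => /eqP <-.
  rewrite /forced zt /=; case E: (edge G z s).
    by have := bS _ _ E; rewrite zS sS.
  apply/negbTE/negP=> /existsP[w /existsP[w']].
  case/and5P=> _ _ _ zw /and3P[_ tw _].
  by have := bS _ _ zw; have := bS _ _ tw; rewrite zS (negbTE tS); case: (w \in S).
case: (pickP [pred x in S | x \in A]) => [x1 /andP[x1S x1A]|N]; last first.
  case: (pickP (mem S)) => [s sS|S0]; last first.
    by exists true, t, t, t, t, t, t => z; have := S0 z => /= ->.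
  exists true, t, t, t, s, t, t => z zS; rewrite (trivial s) //=.
  by have := N z; rewrite /= zS.
case: (pickP [pred x in S | x \notin A]) => [x2 /andP[x2S x2A]|N]; last first.
  exists false, t, t, t, x1, t, t => z zS; rewrite (trivial x1) //=.
  by have := N z; rewrite /= zS /= => /negbFE.
have HA' : single_opposite (~: A) by rewrite single_oppositeC.
have [y1 a1] := anchored_ex bS HA x1S x1A.
have [|y2 a2] := anchored_ex bS HA' x2S _; first by rewrite inE.
case/orP: (residue_small bS cS HA a1 a2) => Q.
  have [a [b E]] := exceptional_colouring HA a1 a2 Q.
  by exists true, x1, y1, x2, y2, a, b.
have [a [b E]] := exceptional_colouring HA' a2 (anchoredC a1) (leqW Q).
exists false, x2, y2, x1, y1, a, b => z zS.
by rewrite -E // inE; case: (z \in A).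
Qed.

Definition same_side x z : bool :=
  (z == x) || [exists w, edge G z w && edge G x w].

Lemma same_sideE S x z :
  bipartition S -> codegrees_positive S -> same_side x z = ((z \in S) == (x \in S)).
Proof.
move=> bS cS; apply/idP/eqP.
  case/orP=> [/eqP-> // | /existsP[w /andP[/bS zw /bS xw]]].
  by move: zw xw; do 3!case: (_ \in S).
move=> E; rewrite /same_side; case: (eqVneq z x) => //= zx.
have [w zw xw] := cS _ _ zx E.
by apply/existsP; exists w; rewrite zw.
Qed.

Definition exceptional (p : nat -> V) (i : nat) (z : V) : bool :=
  [|| z == p i.+4, z == p i.+4.+1 | forced (p i) (p i.+1) (p i.+2) (p i.+3) z].

(** The vertices [p 1], ..., [p 15] describe a colouring: [p 1] selects a side,
    [p 2] to [p 8] describe the colouring of that side, and [p 9] to [p 15] that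
    of the other side. The boolean of [side_colouring] is encoded as equality
    of [p 2] or [p 9] with [p 1]. *)
Definition colour (p : nat -> V) (z : V) : bool :=
  if same_side (p 1) z then (p 2 == p 1) == exceptional p 3 z
  else (p 9 == p 1) == exceptional p 10 z.

(** Each side is described by [side_colouring]. This needs a vertex on either
    side, found as follows: of two vertices with different colours, either they
    lie on different sides or a common neighbour does not lie on theirs. *)
Lemma colouring_definable S A :
  bipartition S -> codegrees_positive S -> proper_cut A ->
  exists p, [set z | colour p z] = A.
Proof.
move=> bS cS /and3P[/set0Pn[u uA] /set0Pn[v]]; rewrite inE => vA HA.
have uv : u != v by apply: contraNneq vA => <-.
have [t tS] : exists t, (t \in S) != (u \in S).
  case: (eqVneq (v \in S) (u \in S)) => [E|]; last by exists v.
  have [w uw _] := cS _ _ uv (esym E).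
  by exists w; rewrite eq_sym bS.
(* The two sides play the same role, so [u] may be taken as [p 1]. *)
wlog uS : S bS cS tS / u \in S.
  move=> W; case uS: (u \in S); first exact: W tS uS.
  apply: (W (~: S)).
  - by move=> x y /bS; rewrite !inE (inj_eq negb_inj).
  - by move=> x y xy E; apply: cS => //; apply: negb_inj; rewrite !inE in E.
  - by rewrite !inE (inj_eq negb_inj).
  by rewrite inE uS.
rewrite uS eqb_id in tS.
have bS' : bipartition (~: S) by move=> x y /bS; rewrite !inE (inj_eq negb_inj).
have cS' : codegrees_positive (~: S).
  by move=> x y xy E; apply: cS => //; apply: negb_inj; rewrite !inE in E.
have uS' : u \notin ~: S by rewrite inE uS.
have [c [x1 [y1 [x2 [y2 [a [b E]]]]]]] := side_colouring bS cS HA tS.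
have [c' [x1' [y1' [x2' [y2' [a' [b' E']]]]]]] := side_colouring bS' cS' HA uS'.
pose f (c : bool) := if c then u else v.
have fE (d : bool) : (f d == u) = d by
  case: d; rewrite /f ?eqxx // eq_sym (negbTE uv).
exists (nth u [:: u; u; f c; x1; y1; x2; y2; a; b;
                  f c'; x1'; y1'; x2'; y2'; a'; b']).
apply/setP=> z; rewrite inE /colour /= (same_sideE _ _ bS cS) uS eqb_id !fE.
by case: ifPn => zS; [rewrite E | rewrite E' // inE].
Qed.

End Cuts.

(** * Arithmetic expressions with bounded sums *)

(** [ESum x e] is the sum of [e] for the variable [x] ranging over the numbers
    below the number of vertices. Nested sums express exhaustive search, and
    the absence of any other iteration keeps the cost polynomial. *)
Inductive expr :=
  | EVar of nat
  | EConst of nat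
  | EAdd of expr & expr
  | ESub of expr & expr
  | ERead of expr
  | ESum of nat & expr.

Fixpoint eval (n : nat) (m : nat -> nat) (env : nat -> nat) (e : expr) : nat :=
  match e with
  | EVar x => env x
  | EConst k => k
  | EAdd a b => eval n m env a + eval n m env b
  | ESub a b => eval n m env a - eval n m env b
  | ERead a => m (eval n m env a)
  | ESum x a => \sum_(k < n) eval n m (upd env x k) a
  end.

Lemma eval_ext n m e env env' :
  env =1 env' -> eval n m env e = eval n m env' e.
Proof.
elim: e env env' => /= [x|k|a IHa b IHb|a IHa b IHb|a IHa|x a IHa] env env' E //.
- by rewrite (IHa _ _ E) (IHb _ _ E).
- by rewrite (IHa _ _ E) (IHb _ _ E).
- by rewrite (IHa _ _ E).
by apply: eq_bigr => k _; apply: IHa => y; rewrite /upd E.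
Qed.

Fixpoint code_size (e : expr) : nat :=
  match e with
  | EVar _ => 2
  | EConst _ => 1
  | EAdd a b | ESub a b => code_size a + code_size b + 1
  | ERead a => code_size a + 1
  | ESum _ a => code_size a + 8
  end.

(** Code to be placed at address [off], with jumps only into itself. Variable
    [x] is held in register [rho x], and all registers in use lie below [d]; the
    value is left in register [d]. In a sum, register [d] accumulates, register
    [d.+1] holds the variable, and the body works from [d.+2]; register 0
    holds the number of vertices throughout. *)
Fixpoint compile (e : expr) (rho : nat -> nat) (d off : nat) : program :=
  match e with
  | EVar x => [:: IConst d 0; IAdd d d (rho x)]
  | EConst k => [:: IConst d k]
  | EAdd a b =>
      compile a rho d off ++ compile b rho d.+1 (off + code_size a)
        ++ [:: IAdd d d d.+1]
  | ESub a b =>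
      compile a rho d off ++ compile b rho d.+1 (off + code_size a)
        ++ [:: ISub d d d.+1]
  | ERead a => compile a rho d off ++ [:: IRead d d]
  | ESum x a =>
      [:: IConst d 0; IConst d.+1 0;
          ISub d.+2 0 d.+1; IJzero d.+2 (off + code_size a + 8)]
        ++ compile a (upd rho x d.+1) d.+2 (off + 4)
        ++ [:: IAdd d d d.+2; IConst d.+2 1; IAdd d.+1 d.+1 d.+2;
               IJump (off + 2)]
  end.

Lemma size_compile e rho d off : size (compile e rho d off) = code_size e.
Proof.
elim: e rho d off => //= [a IHa b IHb|a IHa b IHb|a IHa|x a IHa] rho d off.
- by rewrite !size_cat IHa IHb /= addnA.
- by rewrite !size_cat IHa IHb /= addnA.
- by rewrite !size_cat IHa.
by rewrite size_cat IHa /= -[4]/(0 + 4) !addnS addn0.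
Qed.

(** The exact number of steps: a loop is always run to its end, so it does not
    depend on the values of the variables. *)
Fixpoint runtime (n : nat) (e : expr) : nat :=
  match e with
  | EVar _ => 2
  | EConst _ => 1
  | EAdd a b | ESub a b => runtime n a + runtime n b + 1
  | ERead a => runtime n a + 1
  | ESum _ a => n * (runtime n a + 6) + 4
  end.

Lemma runtime_poly e : exists p : {poly nat}, forall n, p.[n]%R = runtime n e.
Proof.
elim: e => [x|k|a [p Ep] b [q Eq]|a [p Ep] b [q Eq]|a [p Ep]|x a [p Ep]].
- by exists (2%:P)%R => n; rewrite hornerC.
- by exists (1%:P)%R => n; rewrite hornerC.
- by exists (p + q + 1%:P)%R => n; rewrite !hornerD Ep Eq hornerC.
- by exists (p + q + 1%:P)%R => n; rewrite !hornerD Ep Eq hornerC.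
- by exists (p + 1%:P)%R => n; rewrite !hornerD Ep hornerC.
exists ('X * (p + 6%:P) + 4%:P)%R => n.
by rewrite hornerD hornerM hornerX hornerD Ep !hornerC.
Qed.

Local Arguments onth : simpl never.

Fixpoint code_at (P : program) (off : nat) (c : program) : Prop :=
  if c is i :: c' then onth P off = Some i /\ code_at P off.+1 c' else True.

Lemma code_at_cat P off c1 c2 :
  code_at P off (c1 ++ c2) ->
  code_at P off c1 /\ code_at P (off + size c1) c2.
Proof.
elim: c1 off => [|i c1 IH] off /=; first by rewrite addn0.
by case=> Hi /IH [H1 H2]; rewrite addnS -addSn.
Qed.

Lemma code_at_suffix P0 P : code_at (P0 ++ P) (size P0) P.
Proof.
elim: P P0 => //= i P IH P0; split.
  by elim: P0.
by rewrite -cat_rcons -(size_rcons P0 i).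
Qed.

Definition reaches (P : program) (t : nat) (c c' : config) : Prop :=
  iter t (step P) c = c'.

Lemma reaches_trans P t1 t2 c1 c2 c3 :
  reaches P t1 c1 c2 -> reaches P t2 c2 c3 -> reaches P (t1 + t2) c1 c3.
Proof. by rewrite /reaches addnC iterD => -> ->. Qed.

Lemma reaches_step P i l r m t c :
  onth P l = Some i -> reaches P t (exec i (Config l r m)) c ->
  reaches P t.+1 (Config l r m) c.
Proof.
move=> Hi; have E : step P (Config l r m) = exec i (Config l r m).
  by rewrite /step /= Hi.
by rewrite /reaches iterSr E.
Qed.

Lemma upd_same f a v : upd f a v a = v.
Proof. by rewrite /upd eqxx. Qed.

Lemma upd_lt f a v b : b < a -> upd f a v b = f b.
Proof. by move=> H; rewrite /upd ltn_eqF. Qed.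

Lemma upd_gt f a v b : a < b -> upd f a v b = f b.
Proof. by move=> H; rewrite /upd gtn_eqF. Qed.

(** The preservation of the registers below [d] is what allows the code of one
    subexpression to run between the computation of another one and the use
    of its value. *)
Lemma compile_correct n m e P rho d off r :
  0 < d -> r 0 = n -> (forall x, rho x < d) ->
  code_at P off (compile e rho d off) ->
  exists r', [/\ reaches P (runtime n e) (Config off r m)
                   (Config (off + code_size e) r' m),
                 r' d = eval n m (fun x => r (rho x)) e
               & forall i, i < d -> r' i = r i].
Proof.
elim: e rho d off r => /= [x|k|a IHa b IHb|a IHa b IHb|a IHa|x a IHa]
  rho d off r d0 r0 Hrho.
(* Sums and differences differ in their last instruction only. *)
3-4: move=> /code_at_cat [Ha /code_at_cat []].
3-4: rewrite !size_compile => Hb /= [Hi _].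
3-4: have [r1 [R1 E1 L1]] := IHa _ _ _ _ d0 r0 Hrho Ha.
3-4: have r10 : r1 0 = n by rewrite L1.
3-4: have [r2 [R2 E2 L2]] :=
  IHb _ d.+1 _ _ isT r10 (fun x => ltnW (Hrho x)) Hb.
3-4: eexists; split;
  [ apply: reaches_trans (reaches_trans R1 R2) _; apply: (reaches_step Hi);
    rewrite !addnA addn1; exact: erefl
  | by rewrite upd_same L2 // E1 E2 (eval_ext _ _ b (fun x => L1 _ (Hrho x)))
  | by move=> i id; rewrite upd_lt // L2 ?L1 // ltnW ].
- case=> H1 [H2 _]; eexists; split.
  + apply: (reaches_step H1); apply: (reaches_step H2).
    rewrite addn2; exact: erefl.
  + by rewrite !upd_same upd_lt.
  by move=> i Hi; rewrite !upd_lt.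
- case=> H1 _; eexists; split.
  + by apply: (reaches_step H1) => /=; rewrite addn1; exact: erefl.
  + by rewrite upd_same.
  by move=> i Hi; rewrite upd_lt.
- move=> /code_at_cat [Ha]; rewrite !size_compile => /= [[Hi _]].
  have [r1 [R1 E1 L1]] := IHa _ _ _ _ d0 r0 Hrho Ha.
  eexists; split.
  + apply: reaches_trans R1 _.
    by apply: (reaches_step Hi); rewrite addnA addn1; exact: erefl.
  + by rewrite upd_same E1.
  by move=> i Hi'; rewrite upd_lt // L1.
case=> I1 [I2 [I3 [I4 /code_at_cat [Ha]]]]; rewrite size_compile => /=.
case=> I5 [I6 [I7 [I8 _]]].
pose env y := r (rho y).
pose S i := \sum_(k < i) eval n m (upd env x k) a.
(* [j] rounds of the loop remain, and [i] have been performed. *)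
have loop j i r1 : i + j = n -> r1 d = S i -> r1 d.+1 = i ->
  (forall y, y < d -> r1 y = r y) ->
  exists r', [/\ reaches P (j * (runtime n a + 6) + 2) (Config off.+2 r1 m)
                   (Config (off + (code_size a + 8)) r' m),
                 r' d = S n
               & forall y, y < d -> r' y = r y].
  elim: j i r1 => [|j IH] i r1 ij Ed Ei Ey.
    eexists; split.
    - apply: (reaches_step I3) => /=; apply: (reaches_step I4).
      rewrite /= upd_same Ey // r0 Ei -ij addn0 subnn /= addnA; exact: erefl.
    - by rewrite upd_lt // Ed -ij addn0.
    by move=> y Hy; rewrite upd_lt ?Ey // (ltn_trans Hy).
  pose r2 := upd r1 d.+2 (n - i).
  have r20 : r2 0 = n by rewrite /r2 upd_lt // Ey.
  have Hrho' y : upd rho x d.+1 y < d.+2.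
    by rewrite /upd; case: eqP => // _; rewrite (ltn_trans (Hrho y)).
  rewrite addn4 in I4 Ha.
  have [r3 [R3 E3 L3]] := IHa _ d.+2 _ _ isT r20 Hrho' Ha.
  have {}E3 : r3 d.+2 = eval n m (upd env x i) a.
    rewrite E3; apply: eval_ext => y; rewrite /upd.
    case: eqP => _; first by rewrite /r2 upd_lt.
    by rewrite /r2 upd_lt ?Ey // (ltn_trans (Hrho y)).
  have [|||y Hy|r' [R' E' L']] := IH i.+1
    (upd (upd (upd r3 d (r3 d + r3 d.+2)) d.+2 1) d.+1 (r3 d.+1 + 1)).
  - by rewrite addSnnS.
  - rewrite 2?upd_lt // upd_same E3 L3 // /r2 upd_lt // Ed /S.
    by rewrite big_ord_recr.
  - by rewrite upd_same L3 // /r2 upd_lt // Ei addn1.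
  - by rewrite !upd_lt ?L3 ?/r2 ?upd_lt ?Ey // !(ltn_trans Hy).
  exists r'; split=> //.
  have -> : j.+1 * (runtime n a + 6) + 2 =
            2 + (runtime n a + 4) + (j * (runtime n a + 6) + 2) by lia.
  apply: reaches_trans R'; apply: reaches_trans (reaches_trans R3 _).
    apply: (reaches_step I3); apply: (reaches_step I4).
    rewrite /= upd_same Ey // r0 Ei.
    have -> : (n - i == 0) = false by rewrite -ij addnC addnK.
    exact: erefl.
  apply: (reaches_step I5); apply: (reaches_step I6).
  apply: (reaches_step I7); apply: (reaches_step I8); rewrite /= addn2.
  by rewrite upd_same upd_lt // upd_gt.
have [||||r' [R' E' L']] := loop n 0 (upd (upd r d 0) d.+1 0).
- by [].
- by rewrite upd_lt // upd_same /S big_ord0.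
- by rewrite upd_same.
- by move=> y Hy; rewrite !upd_lt // ltnW.
exists r'; split=> //.
have -> : n * (runtime n a + 6) + 4 = (n * (runtime n a + 6) + 2).+2 by lia.
by apply: (reaches_step I1); apply: (reaches_step I2).
Qed.

(** Register 1 holds 0 while the expressions are evaluated, so that all
    variables start with the value 0; it also serves to move the results. *)
Lemma expressions_in_polynomial_time (e1 e2 : expr) :
  exists (P : program) (p : {poly nat}), forall n (G : sgraph 'I_n),
    let c := iter p.[n]%R (step P) (init G) in
    [/\ halted P c,
        reg c 0 = eval n (memory (init G)) (fun=> 0) e1
      & reg c 1 = eval n (memory (init G)) (fun=> 0) e2].
Proof.
pose off := 1 + code_size e1.
pose P := IConst 1 0 :: compile e1 (fun=> 1) 2 1 ++ compile e2 (fun=> 1) 3 off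
  ++ [:: IAdd 0 2 1; IAdd 1 3 1].
have [p1 E1] := runtime_poly e1; have [p2 E2] := runtime_poly e2.
exists P, (p1 + p2 + 3%:P)%R => n G c.
have [I0 /code_at_cat[C1 /code_at_cat[C2]]] : code_at P 0 P.
  exact: (code_at_suffix [::]).
rewrite !size_compile => -[I1 [I2 _]].
rewrite !size_compile in C2.
set m := memory (init G); set r0 := reg (init G).
have [||r1 [R1 V1 L1]] := @compile_correct n m e1 P _ 2 1 (upd r0 1 0) isT _ _ C1.
- by [].
- by [].
have [||r2 [R2 V2 L2]] := @compile_correct n m e2 P _ 3 off r1 isT _ _ C2.
- by rewrite L1.
- by [].
have E : reaches P (1 + runtime n e1 + (runtime n e2 + 2)) (init G)
    (Config (size P) (upd (upd r2 0 (r2 2 + r2 1)) 1 (r2 3 + r2 1)) m).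
  apply: (reaches_trans (c2 := Config (1 + code_size e1) r1 m)).
    by rewrite [1 + runtime n e1]add1n; apply: (reaches_step I0); exact: R1.
  apply: reaches_trans R2 _.
  apply: (reaches_step I1); apply: (reaches_step I2).
  by rewrite /= !size_cat !size_compile /= addnA addn2.
have -> : c = Config (size P) (upd (upd r2 0 (r2 2 + r2 1)) 1 (r2 3 + r2 1)) m.
  rewrite -E /c !hornerD E1 E2 hornerC; congr iter.
  by rewrite -[LHS]/(runtime n e1 + runtime n e2 + 3); lia.
have z1 : r1 1 = 0 by rewrite L1.
have z2 : r2 1 = 0 by rewrite L2.
split; rewrite /halted //=.
  by rewrite /upd /= z2 addn0 L2 // V1; apply: eval_ext.
by rewrite /upd /= z2 addn0 V2; apply: eval_ext => x; rewrite z1.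
Qed.

(** * Logic in expressions *)

(** An expression stands for a formula that is true when its value is not 0.
    Thus addition is disjunction and a sum is an existential quantifier. *)
Definition ENot a := ESub (EConst 1) a.
Definition EAnd a b := ENot (EAdd (ENot a) (ENot b)).
Definition EEq a b := ENot (EAdd (ESub a b) (ESub b a)).
Definition EIff a b := EEq (ENot a) (ENot b).
Definition EIf a b c := EAdd (EAnd a b) (EAnd (ENot a) c).
Definition EAll x a := ENot (ESum x (ENot a)).
Definition EExists xs a := foldr ESum a xs.
Definition ESame x y := EEq (EVar x) (EVar y).

(** The edge between [x] and [y] is stored at address [x * n + y]; the product
    is a sum of [n] copies of [x], over a variable that must differ from [x]. *)
Definition EEdge x y := ERead (EAdd (ESum x.+1 (EVar x)) (EVar y)).

Section Semantics.
Variables (n : nat) (G : sgraph 'I_n).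
Implicit Types (p q : nat -> 'I_n) (a b c : expr) (x y z : nat).

(** Environments whose values are vertices: for these, the value of a formula
    has a direct meaning in the graph. *)
Definition bind p x (k : 'I_n) : nat -> 'I_n :=
  fun y => if y == x then k else p y.

Definition value p a : nat := eval n (memory (init G)) (fun x => p x) a.
Definition holds p a : bool := value p a != 0.

Lemma value_sum p x a : value p (ESum x a) = \sum_k value (bind p x k) a.
Proof.
apply: eq_bigr => k _; apply: eval_ext => y.
by rewrite /upd /bind; case: eqP.
Qed.

Lemma value_not p a : value p (ENot a) = ~~ holds p a.
Proof. by rewrite /holds /value /=; case: eval. Qed.

Lemma holds_not p a : holds p (ENot a) = ~~ holds p a.
Proof. by rewrite {1}/holds value_not; case: holds. Qed.

Lemma holds_or p a b : holds p (EAdd a b) = holds p a || holds p b.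
Proof. by rewrite /holds /value /= addn_eq0 negb_and. Qed.

Lemma holds_and p a b : holds p (EAnd a b) = holds p a && holds p b.
Proof. by rewrite holds_not holds_or !holds_not negb_or !negbK. Qed.

Lemma value_and p a b : value p (EAnd a b) = holds p a && holds p b.
Proof. by rewrite value_not holds_or !holds_not negb_or !negbK. Qed.

Lemma holds_eq p a b : holds p (EEq a b) = (value p a == value p b).
Proof. by rewrite holds_not /holds /value /= addn_eq0 !subn_eq0 negbK eqn_leq. Qed.

Lemma holds_iff p a b : holds p (EIff a b) = (holds p a == holds p b).
Proof. by rewrite holds_eq !value_not; do 2!case: holds. Qed.

Lemma holds_if p a b c :
  holds p (EIf a b c) = if holds p a then holds p b else holds p c.
Proof. by rewrite holds_or !holds_and holds_not; case: ifP; rewrite ?orbF. Qed.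

Lemma holds_same p x y : holds p (ESame x y) = (p x == p y).
Proof. by rewrite holds_eq. Qed.

Lemma holds_lt p a b : holds p (ESub a b) = (value p b < value p a).
Proof. by rewrite ltnNge -subn_eq0. Qed.

Lemma holds_sum p x a : holds p (ESum x a) = [exists k, holds (bind p x k) a].
Proof.
rewrite /holds value_sum sum_nat_eq0 negb_forall.
by apply: eq_existsb => k.
Qed.

Lemma holds_all p x a : holds p (EAll x a) = [forall k, holds (bind p x k) a].
Proof.
rewrite holds_not holds_sum negb_exists.
by apply: eq_forallb => k; rewrite holds_not negbK.
Qed.

Lemma holds_exists p xs a :
  holds p (EExists xs a) <->
  exists2 q, (forall y, y \notin xs -> q y = p y) & holds q a.
Proof.
elim: xs p => [|x xs IH] p /=.
  split=> [H|[q E]]; first by exists p.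
  by rewrite /holds /value (eval_ext _ _ _ (fun y => congr1 val (E y isT))).
rewrite holds_sum; split.
  case/existsP=> k /IH[q E H]; exists q => // y.
  by rewrite inE negb_or => /andP[yx /E ->]; rewrite /bind (negbTE yx).
case=> q E H; apply/existsP; exists (q x); apply/IH; exists q => // y yxs.
by rewrite /bind; case: eqP => [-> // | /eqP yx]; rewrite E // inE negb_or yx.
Qed.

Lemma holds_edge p x y : holds p (EEdge x y) = edge G (p x) (p y).
Proof.
rewrite /holds /value /= (eq_bigr (fun=> val (p x))); last first.
  by move=> k _; rewrite /upd ltn_eqF.
rewrite sum_nat_const card_ord eqb0 negbK mulnC.
apply/existsP/idP => [[i /existsP[j /andP[/eqP E ij]]]|e]; last first.
  by exists (p x); apply/existsP; exists (p y); rewrite eqxx.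
have n0 : 0 < n := leq_ltn_trans (leq0n _) (ltn_ord i).
have -> : p x = i.
  apply: val_inj; have := congr1 (divn^~ n) E.
  by rewrite !divnMDl // !divn_small // !addn0.
have -> // : p y = j.
apply: val_inj; have := congr1 (modn^~ n) E.
by rewrite !modnMDl // !modn_small.
Qed.

(** Conjunction, equality and the universal quantifier unfold to negations, so
    their rules come before those of disjunction and negation. *)
Definition holdsE := (holds_same, holds_iff, holds_all, holds_and, holds_edge,
  holds_sum, holds_or, holds_not).

End Semantics.

(** * The expressions for maximum matching cut *)

(** Variables 1 to 15 hold the vertices that describe a colouring, 16 to 18 are
    bound by the formulas about this colouring, 19 is a bound on the size of
    the cut, and 20 and 21 are bound inside the description. *)
Definition ETwoCommon x y z := ESum 20 (ESum 21
  (EAnd (ENot (ESame 20 21)) (EAnd (ENot (ESame 20 y)) (EAnd (ENot (ESame 21 y))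
  (EAnd (EEdge z 20) (EAnd (EEdge z 21) (EAnd (EEdge x 20) (EEdge x 21)))))))).

Definition EForced x1 y1 x2 y2 z :=
  EAdd (ESame z x1) (EAdd (EAnd (EEdge z y2) (ENot (ESame z x2)))
                          (ETwoCommon x1 y1 z)).

Definition EExceptional i z :=
  EAdd (ESame z i.+4) (EAdd (ESame z i.+4.+1) (EForced i i.+1 i.+2 i.+3 z)).

Definition ESameSide x z :=
  EAdd (ESame z x) (ESum 20 (EAnd (EEdge z 20) (EEdge x 20))).

Definition EColour z :=
  EIf (ESameSide 1 z) (EIff (ESame 2 1) (EExceptional 3 z))
                      (EIff (ESame 9 1) (EExceptional 10 z)).

Definition EProper :=
  EAnd (ESum 16 (EColour 16)) (EAnd (ESum 16 (ENot (EColour 16)))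
    (EAll 16 (EAll 17 (EAll 18 (EAdd (ENot
      (EAnd (EEdge 16 17) (EAnd (EEdge 16 18)
        (EAnd (ENot (EIff (EColour 17) (EColour 16)))
              (ENot (EIff (EColour 18) (EColour 16)))))))
      (ESame 17 18)))))).

Definition ECrossing :=
  ESum 16 (ESum 17 (EAnd (EColour 16) (EAnd (ENot (EColour 17)) (EEdge 16 17)))).

Definition indices := iota 1 15.
Definition EFeasible := EExists indices EProper.

(** The size of the largest cut is the number of [k] such that some described
    cut has more than [k] edges. Letting [k] range below the number of
    vertices misses nothing, as a matching has at most as many edges as the
    graph has vertices. The double negation turns the number of descriptions
    into 0 or 1. *)
Definition EOptimum :=
  ESum 19 (ENot (ENot (EExists indices (EAnd EProper (ESub ECrossing (EVar 19)))))).

Section Meaning.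
Variables (n : nat) (G : sgraph 'I_n).
Implicit Types p : nat -> 'I_n.

Lemma holds_two_common p x y z : x < 20 -> y < 20 -> z < 20 ->
  holds G p (ETwoCommon x y z) = two_common_neighbours G (p x) (p y) (p z).
Proof.
move=> hx hy hz; rewrite holds_sum; apply: eq_existsb => w.
rewrite holds_sum; apply: eq_existsb => w'.
rewrite !holdsE /bind /= (ltn_eqF hx) (ltn_eqF hy) (ltn_eqF hz).
by rewrite (ltn_eqF (leqW hx)) (ltn_eqF (leqW hy)) (ltn_eqF (leqW hz)).
Qed.

Lemma holds_exceptional p i z : i.+4.+1 < 20 -> z < 20 ->
  holds G p (EExceptional i z) = exceptional G p i (p z).
Proof.
move=> hi hz; rewrite !(holds_or, holds_and, holds_not, holds_same, holds_edge).
by rewrite holds_two_common //; lia.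
Qed.

Lemma holds_same_side p x z : x < 20 -> z < 20 ->
  holds G p (ESameSide x z) = same_side G (p x) (p z).
Proof.
move=> hx hz; rewrite !(holds_or, holds_same, holds_sum); congr (_ || _).
by apply: eq_existsb => w; rewrite !holdsE /bind eqxx !ltn_eqF.
Qed.

Lemma holds_colour p z : z < 20 -> holds G p (EColour z) = colour G p (p z).
Proof.
move=> hz; rewrite holds_if !holds_iff !holds_same holds_same_side //.
by rewrite !holds_exceptional.
Qed.

Definition coloured p : {set 'I_n} := [set z | colour G p z].

Lemma holds_proper p : holds G p EProper = proper_cut G (coloured p).
Proof.
rewrite !holds_and !holds_sum !holds_all; congr [&& _, _ & _].
- by apply/existsP/set0Pn=> -[z H]; exists z; move: H; rewrite inE holds_colour.
- apply/existsP/set0Pn=> -[z H]; exists z; move: H;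
    by rewrite !inE holds_not holds_colour.
apply: eq_forallb => z; rewrite holds_all; apply: eq_forallb => w.
rewrite holds_all; apply: eq_forallb => w'.
by rewrite !(holds_colour, holdsE) // !inE implybE.
Qed.

Lemma value_crossing p : value G p ECrossing = #|crossing G (coloured p)|.
Proof.
pose c z w : nat := [&& z \in coloured p, w \notin coloured p & edge G z w].
have -> : #|crossing G (coloured p)| = \sum_z \sum_w c z w.
  rewrite pair_bigA -sum1dep_card big_mkcond.
  by apply: eq_bigr => -[z w] _; rewrite /c /=; case: ifP.
rewrite value_sum.
apply: eq_bigr => z _; rewrite value_sum; apply: eq_bigr => w _.
by rewrite value_and !(holds_colour, holdsE) // /c !inE.
Qed.

(** This is why quantifying over the variables 1 to 15 alone reaches all
    colourings. *)
Lemma coloured_indices p (f : nat -> 'I_n) :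
  exists2 q, (forall y, y \notin indices -> q y = p y) & coloured q = coloured f.
Proof.
exists (fun y => if y \in indices then f y else p y) => [y /negbTE-> //|].
exact: erefl.
Qed.

End Meaning.

Lemma sum_lt_nat k n : \sum_(i < n) (i < k) = minn k n.
Proof. by elim: n => [|n IH]; rewrite ?big_ord0 ?big_ord_recr /= ?IH; lia. Qed.

(** Only sets that pass [EProper] are counted, and [colouring_definable] shows
    that none is missed. The empty graph is treated apart, as its variables
    cannot hold vertices. *)
Lemma optimum_correct n (G : sgraph 'I_n) :
  bipartite G -> diameter_at_most G 3 ->
  let feasible := eval n (memory (init G)) (fun=> 0) EFeasible in
  let optimum := eval n (memory (init G)) (fun=> 0) EOptimum in
  max_matching_cut G (if feasible == 0 then None else Some optimum).
Proof.
move=> bG dG; have [S bS] := bipartite_bipartition bG.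
have cS := diameter3_codegrees bS dG.
case: n G S bG dG bS cS => [|n] G S bG dG bS cS feasible optimum.
  by rewrite /feasible /= big_ord0 => M /matching_cutP[A /and3P[/set0Pn[[]]]].
pose p0 (x : nat) : 'I_n.+1 := ord0.
rewrite -[feasible]/(value G p0 EFeasible) -[optimum]/(value G p0 EOptimum).
have complete p A : proper_cut G A -> exists2 q,
    (forall y, y \notin indices -> q y = p y) & coloured G q = A.
  move=> PA; have [f <-] := colouring_definable bS cS PA.
  exact: coloured_indices.
case: ifPn => [F0 M /matching_cutP[A PA _]|F].
  have [p Ep EA] := complete p0 A PA.
  move: F0; rewrite -[_ == 0]negbK => /negP; apply.
  by apply/holds_exists; exists p; rewrite ?holds_proper ?EA.
have /holds_exists[p1 _] : holds G p0 EFeasible := F.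
rewrite holds_proper => P1.
case: (arg_maxnP (fun A => #|crossing G A|) P1) => A PA maxA.
have -> : value G p0 EOptimum = #|crossing G A|.
  rewrite value_sum (eq_bigr (fun k : 'I__ => nat_of_bool (k < #|crossing G A|))).
    rewrite sum_lt_nat; apply/minn_idPl.
    by case/and3P: PA => _ _ /card_crossing_le; rewrite card_ord.
  move=> k _; rewrite value_not holds_not negbK; congr nat_of_bool.
  apply/idP/idP => [/holds_exists[q Eq]|kA].
    rewrite holds_and holds_lt holds_proper value_crossing => /andP[/maxA].
    by rewrite /value /= Eq // => leA kq; apply: leq_trans kq leA.
  have [q Eq EA] := complete (bind p0 19 k) A PA.
  apply/holds_exists; exists q => //.
  rewrite holds_and holds_lt holds_proper value_crossing EA.
  by rewrite /value /= Eq // PA.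
split.
  exists (cut_edges G A (~: A)); last exact: card_cut_edges.
  by apply/matching_cutP; exists A.
by move=> M /matching_cutP[B PB ->]; rewrite card_cut_edges; apply: maxA.
Qed.

Theorem theorem12 :
  solvable_in_polynomial_time
    (fun n (G : sgraph 'I_n) (answer : option nat) => max_matching_cut G answer)
    (fun n (G : sgraph 'I_n) => bipartite G /\ diameter_at_most G 3).
Proof.
have [P [p H]] := expressions_in_polynomial_time EFeasible EOptimum.
exists P, p => n G [bG dG] c; have [hP E0 E1] := H n G.
by split=> //; rewrite /output E0 E1; apply: optimum_correct.
Qed.
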